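(* For $n\ge 1$ let $P_n(t)=\Delta_{2n+1}(t)=\dfrac{\det\big(I-M(t)^{2n+1}\big)}{1+t+t^2+t^3}$ be the sequence of Alexander polynomials of the knots $Th(4,2n+1)$. Then the sequence $(P_n(t))_{n\ge 1}$ satisfies a homogeneous linear recurrence of order at most $8$ whose coefficients are independent of $n$: there are an integer $d\le 8$ and $c_0(t),\dots,c_d(t)\in\mathbb{Z}[t,t^{-1}]$ with $c_d(t)\neq 0$ such that $\sum_{j=0}^{d}c_j(t)P_{n+j}(t)=0$ for all $n\ge 1$. Moreover the sequence admits a rational generating function: the formal power series $\sum_{n\ge 1}P_n(t)x^n$ equals $N(x,t)/D(x,t)$ for some polynomials $N,D$ in $x$ with coefficients in $\mathbb{Z}[t,t^{-1}]$, $D\ne 0$.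
   Context: $Th(4,q)$ denotes the closure of the 4-strand braid $(\sigma_1\sigma_2^{-1}\sigma_3)^q\in B_4$; for odd $q=2n+1$ it is a knot. The reduced Burau representation $\rho:B_4\to GL_3(\mathbb{Z}[t,t^{-1}])$ is given by $$\rho(\sigma_1)=\begin{pmatrix}-t&1&0\\0&1&0\\0&0&1\end{pmatrix},\quad \rho(\sigma_2)^{-1}=\begin{pmatrix}1&0&0\\1&-t^{-1}&t^{-1}\\0&0&1\end{pmatrix},\quad \rho(\sigma_3)=\begin{pmatrix}1&0&0\\0&1&0\\0&t&-t\end{pmatrix},$$ and $$M(t)=\rho(\sigma_1\sigma_2^{-1}\sigma_3)=\begin{pmatrix}1-t&1-t^{-1}&-1\\1&1-t^{-1}&-1\\0&t&-t\end{pmatrix}.$$ By Burau's classical identity, the Alexander polynomial of $Th(4,q)$ is, up to a unit $\pm t^k$, equal to $\det(I-M(t)^q)/(1+t+t^2+t^3)$; this quotient is the representative used here. *)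

(* Defs.v *)
From HB Require Import structures.
From mathcomp Require Import all_boot all_order all_algebra.
From mathcomp Require Import ring.

Set Implicit Arguments.
Unset Strict Implicit.
Unset Printing Implicit Defensive.

Import GRing.Theory.
Local Open Scope ring_scope.

(* Q(t) as the fraction field of Z[t]; Z[t, t^-1] is handled as the subring   *)
(* [laurent] of this field.                                                   *)
Definition Qt : fieldType := {fraction {poly int}}.

Definition ofpoly (p : {poly int}) : Qt := @FracField.tofrac {poly int} p.

Definition t : Qt := ofpoly 'X.

Definition laurent (f : Qt) : Prop :=
  exists (p : {poly int}) (k : nat), f = ofpoly p / t ^+ k.

Definition mx3 (F : fieldType) (rows : seq (seq F)) : 'M[F]_3 :=
  \matrix_(i < 3, j < 3) nth 0 (nth [::] rows i) j.

(* Reduced Burau matrices of sigma_1, sigma_2^-1 and sigma_3 in B_4, with the *)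
(* variable evaluated at an element t of a field F.                           *)
Definition burau1 (F : fieldType) (t : F) : 'M[F]_3 :=
  mx3 [:: [:: - t; 1; 0]; [:: 0; 1; 0]; [:: 0; 0; 1]].

Definition burau2V (F : fieldType) (t : F) : 'M[F]_3 :=
  mx3 [:: [:: 1; 0; 0]; [:: 1; - t^-1; t^-1]; [:: 0; 0; 1]].

Definition burau3 (F : fieldType) (t : F) : 'M[F]_3 :=
  mx3 [:: [:: 1; 0; 0]; [:: 0; 1; 0]; [:: 0; t; - t]].

Definition M (F : fieldType) (t : F) : 'M[F]_3 :=
  burau1 t *m burau2V t *m burau3 t.

(* Burau's representative of the Alexander polynomial of Th(4, q); the        *)
(* division is that of Q(t), and [alexTh_laurent] below shows that it is      *)
(* exact in Z[t, t^-1].                                                       *)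
Definition alexTh (q : nat) : Qt :=
  \det (1%:M - M t ^+ q) / (1 + t + t ^+ 2 + t ^+ 3).

Definition P (n : nat) : Qt := alexTh (2 * n + 1)%N.

(* Formal power series in x over R are their coefficient sequences nat -> R,  *)
(* multiplied by the Cauchy product.                                          *)
Definition psmul (R : pzRingType) (a b : nat -> R) : nat -> R :=
  fun n => \sum_(i < n.+1) a i * b (n - i)%N.

Definition ps_of_poly (R : nzRingType) (p : {poly R}) : nat -> R :=
  fun n => p`_n.

(* S = N / D in the fraction field of R[[x]].                                 *)
Definition ps_eq_ratio (R : idomainType) (S : nat -> R) (N D : {poly R}) :
    Prop :=
  D != 0 /\ psmul (ps_of_poly D) S =1 ps_of_poly N.

Definition genP : nat -> Qt := fun n => if (1 <= n)%N then P n else 0.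

Lemma t_neq0 : t != 0.
Proof. by rewrite /t /ofpoly tofrac_eq0 polyX_eq0. Qed.

Lemma burau_den_neq0 : 1 + t + t ^+ 2 + t ^+ 3 != 0.
Proof.
rewrite /t /ofpoly -tofrac1 -!tofracXn -!tofracD tofrac_eq0.
apply/eqP => /(congr1 (fun p : {poly int} => p.[0])).
by rewrite !hornerE.
Qed.

Lemma M_explicit (F : fieldType) (t : F) : t != 0 ->
  M t = mx3 [:: [:: 1 - t; 1 - t^-1; -1]; [:: 1; 1 - t^-1; -1]; [:: 0; t; - t]].
Proof.
move=> t0; apply/matrixP => i j; rewrite /M !mxE !big_ord_recl big_ord0 !mxE.
rewrite !big_ord_recl !big_ord0 !mxE /=.
by case: i => [] [|[|[|//]]] hi; case: j => [] [|[|[|//]]] hj /=; field.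
Qed.

Lemma det_sub1_Mexp (F : fieldType) (t : F) (q : nat) : t != 0 ->
  \det (1%:M - M t ^+ q) =
  (1 + t + t ^+ 2 + t ^+ 3) *
  \det (mx3 [:: [:: 0; 0; t^-1 ^+ 2]; [:: -1; t^-1; 1]; [:: 0; - t; 1 + t]]
        *m \sum_(i < q) M t ^+ i).
Proof.
move=> t0; set s := 1 + t + t ^+ 2 + t ^+ 3; set W := mx3 _.
pose U := mx3 [:: [:: 1; t; t^-1 ^+ 2]; [:: 0; 1; 0]; [:: 0; 0; 1]].
pose Dg := mx3 [:: [:: s; 0; 0]; [:: 0; 1; 0]; [:: 0; 0; 1]].
have detU : \det U = 1.
  rewrite -det_tr det_trig; first by rewrite !big_ord_recl big_ord0 !mxE /=; ring.
  apply/is_trig_mxP => i j; rewrite !mxE.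
  by case: i => [] [|[|[|//]]] hi; case: j => [] [|[|[|//]]].
have detD : \det Dg = s.
  rewrite det_trig; first by rewrite !big_ord_recl big_ord0 !mxE /=; ring.
  apply/is_trig_mxP => i j; rewrite !mxE.
  by case: i => [] [|[|[|//]]] hi; case: j => [] [|[|[|//]]].
have UW : U *m (1%:M - M t) = Dg *m W.
  apply/matrixP => i j; rewrite M_explicit // !mxE !big_ord_recl !big_ord0 !mxE.
  by case: i => [] [|[|[|//]]] hi; case: j => [] [|[|[|//]]] hj /=;
     rewrite /s; field.
have -> : 1%:M - M t ^+ q = (1%:M - M t) *m \sum_(i < q) M t ^+ i.
  apply: oppr_inj; rewrite -mulNmx !opprB; exact: subrX1.
rewrite -[LHS]mul1r -[X in X * _]detU -det_mulmx mulmxA UW -mulmxA.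
by rewrite det_mulmx detD.
Qed.

Lemma laurent_poly p : laurent (ofpoly p).
Proof. by exists p, 0%N; rewrite expr0 divr1. Qed.

Lemma laurentD f g : laurent f -> laurent g -> laurent (f + g).
Proof.
move=> [p [k ->]] [q [l ->]].
exists (p * 'X^l + q * 'X^k), (k + l)%N.
rewrite /ofpoly tofracD !tofracM !tofracXn -!/(ofpoly _) -/t exprD.
by rewrite addf_div // expf_neq0 ?t_neq0.
Qed.

Lemma laurentM f g : laurent f -> laurent g -> laurent (f * g).
Proof.
move=> [p [k ->]] [q [l ->]]; exists (p * q), (k + l)%N.
by rewrite /ofpoly tofracM exprD invfM mulrACA.
Qed.

Lemma laurent0 : laurent 0.
Proof. by have := laurent_poly 0; rewrite /ofpoly tofrac0. Qed.

Lemma laurent1 : laurent 1.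
Proof. by have := laurent_poly 1; rewrite /ofpoly tofrac1. Qed.

Lemma laurentN f : laurent f -> laurent (- f).
Proof.
move=> [p [k ->]]; exists (- p), k.
by rewrite /ofpoly tofracN mulNr.
Qed.

Lemma laurent_t : laurent t. Proof. exact: laurent_poly. Qed.

Lemma laurent_tV : laurent t^-1.
Proof. by exists 1, 1%N; rewrite /ofpoly tofrac1 mul1r expr1. Qed.

Lemma laurent_sum (I : Type) (r : seq I) (Q : pred I) (F : I -> Qt) :
  (forall i, laurent (F i)) -> laurent (\sum_(i <- r | Q i) F i).
Proof. by move=> hF; apply: (big_ind laurent laurent0 laurentD). Qed.

Lemma laurent_prod (I : Type) (r : seq I) (Q : pred I) (F : I -> Qt) :
  (forall i, laurent (F i)) -> laurent (\prod_(i <- r | Q i) F i).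
Proof. by move=> hF; apply: (big_ind laurent laurent1 laurentM). Qed.

Lemma laurent_det n (A : 'M[Qt]_n) :
  (forall i j, laurent (A i j)) -> laurent (\det A).
Proof.
move=> hA; apply: laurent_sum => s; apply: laurentM; last first.
  by apply: laurent_prod.
by case: (perm.odd_perm s); rewrite ?expr1 ?expr0; [apply: laurentN|];
   apply: laurent1.
Qed.

Lemma laurent_M i j : laurent (M t i j).
Proof.
have h0 := laurent0; have h1 := laurent1.
have ht := laurent_t; have htV := laurent_tV.
have hB f : laurent f -> laurent (1 - f).
  by move=> hf; apply: laurentD => //; apply: laurentN.
rewrite M_explicit ?t_neq0 // mxE.
by case: i => [] [|[|[|//]]] hi; case: j => [] [|[|[|//]]] hj //=;
   (exact: hB || exact: laurentN).
Qed.

Lemma laurent_Mexp q i j : laurent ((M t ^+ q) i j).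
Proof.
elim: q i j => [|q IHq] i j.
  by rewrite expr0 mxE; case: (i == j); [apply: laurent1|apply: laurent0].
rewrite exprS mxE; apply: laurent_sum => k; apply: laurentM => //.
exact: laurent_M.
Qed.

Lemma alexTh_laurent q : laurent (alexTh q).
Proof.
rewrite /alexTh det_sub1_Mexp ?t_neq0 // mulrC mulKf ?burau_den_neq0 //.
rewrite det_mulmx; apply: laurentM; apply: laurent_det => i j; last first.
  by rewrite summxE; apply: laurent_sum => k; apply: laurent_Mexp.
have h0 := laurent0; have h1 := laurent1.
have ht := laurent_t; have htV := laurent_tV.
rewrite mxE.
by case: i => [] [|[|[|//]]] hi; case: j => [] [|[|[|//]]] hj //=;
   (exact: laurentM || exact: laurentN || exact: laurentD).
Qed.

(* Main.v *)
Require Import Defs.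
From mathcomp Require Import all_boot all_order all_algebra.
From mathcomp Require Import ring.

(** For a 3 x 3 matrix [A],
      [\det (1 - A) = 1 - \tr A + \tr (\adj A) - \det A],
    the alternating sum of the traces of the exterior powers of [A].  Both
    [\adj] and [\det] commute with powers of an invertible matrix, so taking
    [A = M t ^+ (2 * n + 1)] writes the numerator of [P n] as a combination of
    - the constant 1,
    - [\tr (M t *m (M t ^+ 2) ^+ n)],
    - [\tr (\adj (M t) *m (\adj (M t) ^+ 2) ^+ n)],
    - [\det (M t) * (\det (M t) ^+ 2) ^+ n].
    As functions of [n] these satisfy the linear recurrences whose
    characteristic polynomials are [X - 1], the characteristic polynomials of
    [M t ^+ 2] and of [\adj (M t) ^+ 2] (by the Cayley-Hamilton theorem), and
    [X - \det (M t) ^+ 2], of degrees 1, 3, 3 and 1.  Their product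
    [annihilator (M t)] is therefore the characteristic polynomial of a
    recurrence of order 8 for [P] ([P_rec]).  It is monic, which makes the
    leading coefficient of the recurrence nonzero, and its coefficients are
    Laurent polynomials because they are built from the entries of [M t] by
    sums, products and opposites ([laurent_coefs_annihilator]).

    The generating function is rational as for any linear recurrence: its
    denominator is the reversed characteristic polynomial, and the product of
    the series with it vanishes beyond degree 8 ([linear_rec_ps_ratio]). *)

Set Implicit Arguments.
Unset Strict Implicit.
Unset Printing Implicit Defensive.

Import GRing.Theory.
Local Open Scope ring_scope.

Lemma det_sub1_mx3 (R : comNzRingType) (A : 'M[R]_3) :
  \det (1%:M - A) = 1 - \tr A + \tr (\adj A) - \det A.
Proof.
rewrite /mxtrace !big_ord_recl !big_ord0 !mxE.
rewrite !(expand_det_row _ ord0) /cofactor !big_ord_recl !big_ord0 !mxE.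
rewrite /cofactor !(expand_det_row _ ord0) /cofactor.
rewrite !big_ord_recl !big_ord0 !det_mx11 !mxE /=.
(* Ordinals with equal values but different proofs must become one atom for [ring]. *)
pose a (i j : nat) := A (inord i) (inord j).
have aE i j : A i j = a i j by rewrite /a !inord_val.
rewrite !aE /= /bump /=; ring.
Qed.

Lemma det_mxX (R : comNzRingType) m (A : 'M[R]_m.+1) q :
  \det (A ^+ q) = \det A ^+ q.
Proof.
elim: q => [|q IHq]; first by rewrite !expr0 det1.
by rewrite !exprS -IHq -det_mulmx.
Qed.

(** Over a field with [A] invertible, [\adj (A ^+ q)] is determined by
    [A ^+ q *m \adj (A ^+ q) = (\det A ^+ q)%:M], an equation that
    [\adj A ^+ q] also satisfies since [A] and [\adj A] commute. *)
Lemma adj_mxX (F : fieldType) m (A : 'M[F]_m.+1) q :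
  A \in unitmx -> \adj (A ^+ q) = \adj A ^+ q.
Proof.
move=> uA; have uAq : A ^+ q \in unitmx by rewrite unitmxE det_mxX unitrX.
apply: (can_inj (mulKmx uAq)); rewrite mul_mx_adj det_mxX.
have cA : A * \adj A = \adj A * A.
  by rewrite -[LHS]/(A *m _) -[RHS]/(_ *m A) mul_mx_adj mul_adj_mx.
rewrite -[RHS]/(_ ^+ q * _ ^+ q) -exprMn_comm //.
by rewrite -[A * _]/(A *m _) mul_mx_adj -rmorphXn.
Qed.

(** The sum is [\tr (X *m A ^+ n *m p(A))].  The polynomial [p] only has to
    annihilate [A], so a single [p] can serve several matrices at once; this
    replaces any calculus of products of recurrences. *)
Lemma mxtrace_annihilated (R : comNzRingType) m (A X : 'M[R]_m.+1)
    (p : {poly R}) (k n : nat) :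
  (size p <= k)%N -> horner_mx A p = 0 ->
  \sum_(j < k) p`_j * \tr (X *m A ^+ (n + j)) = 0.
Proof.
move=> sp pA.
transitivity (\tr (X *m (A ^+ n *m horner_mx A p))); last first.
  by rewrite pA !mulmx0 mxtrace0.
rewrite [in RHS](_ : p = \poly_(j < k) p`_j); last first.
  apply/polyP => j; rewrite coef_poly; case: ltnP => // kj.
  by rewrite nth_default // (leq_trans sp).
rewrite poly_def !(raddf_sum, mulmx_sumr) /=; apply: eq_bigr => j _.
rewrite linearZ rmorphXn /= horner_mx_X -!scalemxAr mxtraceZ.
by rewrite -[A ^+ n *m _]/(_ * _) exprD.
Qed.

Lemma expr_annihilated (R : comNzRingType) (a b : R) (p : {poly R})
    (k n : nat) :
  (size p <= k)%N -> root p a ->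
  \sum_(j < k) p`_j * (b * a ^+ (n + j)) = 0.
Proof.
move=> sp /rootP pa.
transitivity (b * (a ^+ n * p.[a])); last by rewrite pa !mulr0.
rewrite (horner_coef_wide _ sp) !mulr_sumr; apply: eq_bigr => j _.
by rewrite exprD; ring.
Qed.

(** The roots are the squares of the products of the eigenvalues of [A] over
    the subsets of the spectrum: this is the characteristic polynomial of
    [A ^+ 2] acting on the exterior algebra. *)
Definition annihilator (F : fieldType) (A : 'M[F]_3) : {poly F} :=
  ('X - 1%:P) * char_poly (A ^+ 2) * char_poly (\adj A ^+ 2)
  * ('X - (\det A ^+ 2)%:P).

Lemma annihilator_monic (F : fieldType) (A : 'M[F]_3) :
  annihilator A \is monic.
Proof. by rewrite !monicMr ?char_poly_monic ?monicXsubC. Qed.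

Lemma size_annihilator (F : fieldType) (A : 'M[F]_3) :
  size (annihilator A) = 9.
Proof.
have nz (B : 'M[F]_3) : char_poly B != 0 by rewrite monic_neq0 ?char_poly_monic.
by rewrite size_Mmonic ?monicXsubC ?mulf_neq0 ?polyXsubC_eq0 // ?size_mul //
  ?mulf_neq0 ?polyXsubC_eq0 // !size_char_poly !size_XsubC.
Qed.

Lemma det_sub1_odd_pow_rec (F : fieldType) (A : 'M[F]_3) (n : nat) :
  A \in unitmx ->
  \sum_(j < 9)
    (annihilator A)`_j * \det (1%:M - A ^+ (2 * (n + j) + 1)) = 0.
Proof.
move=> uA; set p := annihilator A.
have sp : (size p <= 9)%N by rewrite size_annihilator.
have p1 : root p 1 by rewrite !rootM root_XsubC eqxx.
have pd : root p (\det A ^+ 2) by rewrite !rootM !root_XsubC eqxx !orbT.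
have pA : horner_mx (A ^+ 2) p = 0.
  by rewrite !rmorphM /= Cayley_Hamilton mulr0 !mul0r.
have pC : horner_mx (\adj A ^+ 2) p = 0.
  by rewrite !rmorphM /= Cayley_Hamilton mulr0 !mul0r.
have oddX (R : pzRingType) (x : R) k : x ^+ (2 * k + 1) = x * (x ^+ 2) ^+ k.
  by rewrite addn1 exprS exprM.
have := mxtrace_annihilated A n sp pA.
have := mxtrace_annihilated (\adj A) n sp pC.
have := expr_annihilated 1 n sp p1.
have := expr_annihilated (\det A) n sp pd.
set Sd := \sum_(j < 9) _ => hd; set S1 := \sum_(j < 9) _ => h1.
set SC := \sum_(j < 9) _ => hC; set SA := \sum_(j < 9) _ => hA.
transitivity (S1 - SA + SC - Sd); last by rewrite hd h1 hC hA; ring.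
rewrite /S1 /SA /SC /Sd -!(sumrB, big_split) /=; apply: eq_bigr => j _.
by rewrite det_sub1_mx3 adj_mxX // det_mxX !oddX expr1n -!mulmxE; ring.
Qed.

Lemma det_M (F : fieldType) (t : F) : t != 0 -> \det (M t) = - t.
Proof.
move=> t0; rewrite M_explicit // (expand_det_row _ ord0).
rewrite /cofactor !big_ord_recl !big_ord0 !mxE.
rewrite !(expand_det_row _ ord0) /cofactor.
by rewrite !big_ord_recl !big_ord0 !det_mx11 !mxE /=; field.
Qed.

Lemma P_rec n : \sum_(j < 9) (annihilator (M t))`_j * P (n + j) = 0.
Proof.
have uM : M t \in unitmx by rewrite unitmxE unitfE det_M ?oppr_eq0 t_neq0.
under eq_bigr do rewrite /P /alexTh mulrA.
by rewrite -mulr_suml det_sub1_odd_pow_rec ?mul0r.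
Qed.

Definition laurent_coefs (p : {poly Qt}) : Prop := forall i, laurent p`_i.

Lemma laurent_coefsC c : laurent c -> laurent_coefs c%:P.
Proof. by move=> hc i; rewrite coefC; case: eqP => // _; apply: laurent0. Qed.

Lemma laurent_coefsD p q :
  laurent_coefs p -> laurent_coefs q -> laurent_coefs (p + q).
Proof. by move=> hp hq i; rewrite coefD; apply: laurentD. Qed.

Lemma laurent_coefsN p : laurent_coefs p -> laurent_coefs (- p).
Proof. by move=> hp i; rewrite coefN; apply: laurentN. Qed.

Lemma laurent_coefsM p q :
  laurent_coefs p -> laurent_coefs q -> laurent_coefs (p * q).
Proof.
by move=> hp hq i; rewrite coefM; apply: laurent_sum => j; apply: laurentM.
Qed.

Lemma laurent_coefsX : laurent_coefs 'X.
Proof.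
by move=> i; rewrite coefX; case: eqP => _; [apply: laurent1|apply: laurent0].
Qed.

Lemma laurent_coefsXsubC c : laurent c -> laurent_coefs ('X - c%:P).
Proof.
move=> hc; apply: laurent_coefsD; first exact: laurent_coefsX.
exact/laurent_coefsN/laurent_coefsC.
Qed.

(** The Leibniz formula only uses sums, products and signs. *)
Lemma laurent_coefs_det n (A : 'M[{poly Qt}]_n) :
  (forall i j, laurent_coefs (A i j)) -> laurent_coefs (\det A).
Proof.
have h0 := laurent_coefsC laurent0; have h1 := laurent_coefsC laurent1.
move=> hA; apply: (big_ind laurent_coefs h0 laurent_coefsD) => s _.
apply: laurent_coefsM; last first.
  exact: (big_ind laurent_coefs h1 laurent_coefsM).
by case: (perm.odd_perm s); rewrite ?expr1 ?expr0 //; apply: laurent_coefsN.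
Qed.

Lemma laurent_coefs_char_poly n (A : 'M[Qt]_n) :
  (forall i j, laurent (A i j)) -> laurent_coefs (char_poly A).
Proof.
move=> hA; apply: laurent_coefs_det => i j; rewrite !mxE.
case: eqP => _; first exact: laurent_coefsXsubC.
by rewrite mulr0n add0r; apply/laurent_coefsN/laurent_coefsC.
Qed.

Lemma laurent_mul_mx n (A B : 'M[Qt]_n) :
  (forall i j, laurent (A i j)) -> (forall i j, laurent (B i j)) ->
  forall i j, laurent ((A *m B) i j).
Proof.
by move=> hA hB i j; rewrite mxE; apply: laurent_sum => k; apply: laurentM.
Qed.

Lemma laurent_adj n (A : 'M[Qt]_n) :
  (forall i j, laurent (A i j)) -> forall i j, laurent (\adj A i j).
Proof.
move=> hA i j; rewrite mxE /cofactor; apply: laurentM; last first.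
  by apply: laurent_det => k l; rewrite !mxE.
elim: (j + i)%N => [|k IHk]; first by rewrite expr0; apply: laurent1.
by rewrite exprS mulN1r; apply: laurentN.
Qed.

Lemma laurent_coefs_annihilator (A : 'M[Qt]_3) :
  (forall i j, laurent (A i j)) -> laurent_coefs (annihilator A).
Proof.
move=> hA; have hC := laurent_adj hA.
have hd := laurent_det hA.
apply: laurent_coefsM.
  apply: laurent_coefsM.
    apply: laurent_coefsM; first exact/laurent_coefsXsubC/laurent1.
    exact/laurent_coefs_char_poly/laurent_mul_mx.
  exact/laurent_coefs_char_poly/laurent_mul_mx.
exact/laurent_coefsXsubC/laurentM.
Qed.

(** With the coefficients of the recurrence reversed in [D], the coefficient of
    index [n] of [D * S] for [n > d] is the recurrence at index [n - d >= 1], so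
    truncating this product at degree [d] gives the numerator. *)
Lemma linear_rec_ps_ratio (R : idomainType) (d : nat) (c S : nat -> R) :
  c d != 0 ->
  (forall n, (1 <= n)%N -> \sum_(j < d.+1) c j * S (n + j)%N = 0) ->
  let D := \poly_(i < d.+1) c (d - i)%N in
  ps_eq_ratio S (\poly_(n < d.+1) psmul (ps_of_poly D) S n) D.
Proof.
move=> cd0 rec D; split.
  apply/eqP => /(congr1 (fun p : {poly R} => p`_0)).
  by rewrite coef_poly subn0 coef0; apply/eqP.
move=> n; rewrite [RHS]coef_poly; case: ltnP => // ltdn.
rewrite -[RHS](rec (n - d)%N) ?subn_gt0 // (reindex_inj rev_ord_inj) /=.
transitivity (\sum_(i < d.+1) c (d - i)%N * S (n - i)%N); last first.
  apply: eq_bigr => i _; have id : (i <= d)%N by rewrite -ltnS.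
  by rewrite subSS addnBA // subnK // ltnW.
rewrite (big_ord_widen n.+1 (fun i => c (d - i)%N * S (n - i)%N)) 1?ltnW //.
rewrite [RHS]big_mkcond; apply: eq_bigr => i _.
by rewrite /ps_of_poly coef_poly; case: ifP => // _; rewrite mul0r.
Qed.

Theorem theorem2p5 :
  (exists d : nat, (d <= 8)%N /\
    exists c : 'I_d.+1 -> Qt,
      [/\ forall j, laurent (c j),
          c ord_max != 0
        & forall n : nat, (1 <= n)%N ->
            \sum_(j < d.+1) c j * P (n + j)%N = 0])
  /\
  (exists N D : {poly Qt},
      [/\ forall i : nat, laurent N`_i,
          forall i : nat, laurent D`_i
        & ps_eq_ratio genP N D]).
Proof.
set p := annihilator (M t).
have lp : laurent_coefs p by apply/laurent_coefs_annihilator/laurent_M.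
have p8 : p`_8 != 0.
  have := annihilator_monic (M t); rewrite monicE lead_coefE size_annihilator.
  by move/eqP=> ->; apply: oner_neq0.
split.
  exists 8; split=> //; exists (fun j => p`_j).
  by split=> [j|//|n _]; [exact: lp | exact: P_rec].
pose D := \poly_(i < 9) p`_(8 - i).
have lD : laurent_coefs D.
  by move=> i; rewrite coef_poly; case: ifP => _ //; apply: laurent0.
exists (\poly_(n < 9) psmul (ps_of_poly D) genP n), D; split=> //.
  move=> i; rewrite coef_poly; case: ifP => _; last exact: laurent0.
  apply: laurent_sum => j; apply: laurentM; first exact: lD.
  by rewrite /genP; case: ifP => _; [apply: alexTh_laurent | apply: laurent0].
apply: (@linear_rec_ps_ratio _ 8 (fun j => p`_j)) => // n n1.
rewrite -[RHS](P_rec n); apply: eq_bigr => j _.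
by rewrite /genP (leq_trans n1) ?leq_addr.
Qed.
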